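(* Let $\alpha\in(0,1)$ be a quadratic irrational and let $c_\alpha$ be the characteristic Sturmian word with slope $\alpha$. Let $y$ and $y'$ be purely periodic infinite words, and let $x$ be the infinite word obtained from $c_\alpha$ by replacing, for each $j\ge1$, the $j$-th occurrence of $0$ in $c_\alpha$ by the $j$-th letter of $y$ and the $j$-th occurrence of $1$ in $c_\alpha$ by the $j$-th letter of $y'$. Then $x$ is Ostrowski $\alpha$-automatic: there is a deterministic finite automaton with output which, on input the Ostrowski $\alpha$-representation $b_jb_{j-1}\cdots b_0$ of a positive integer $n$, outputs $x[n]$, the $n$-th letter of $x$ (indexing from $1$).
   Context: Let $\alpha=[0,d_1,d_2,\ldots]$ be the continued fraction expansion. The characteristic Sturmian word $c_\alpha$ is the limit of the standard words $s_0=0$, $s_1=0^{d_1-1}1$, $s_n=s_{n-1}^{d_n}s_{n-2}$ ($n\ge2$). Define $q_{-2}=1$, $q_{-1}=0$, $q_n=d_nq_{n-1}+q_{n-2}$ for $n\ge0$. The Ostrowski $\alpha$-representation of a non-negative integer $N$ is the unique digit string $b_jb_{j-1}\cdots b_0$ with $N=\sum_{0\le i\le j}b_iq_i$, where $0\le b_0<d_1$, $0\le b_i\le d_{i+1}$ for $i\ge1$, and for $i\ge1$, $b_i=d_{i+1}$ implies $b_{i-1}=0$. A quadratic irrational is an irrational real root of a quadratic polynomial with integer coefficients. *)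

(* Defs.v *)
From mathcomp Require Import all_boot all_order all_algebra.
From mathcomp Require Import classical_sets reals.

Set Implicit Arguments.
Unset Strict Implicit.
Unset Printing Implicit Defensive.

Import Order.TTheory GRing.Theory Num.Theory.

Definition quadratic_irrational (R : realType) (a : R) : Prop :=
  irrational a /\
  exists2 p : {poly int}, size p = 3 & root (map_poly (intr : int -> R) p) a.

(* Complete quotients and partial quotients of a >= 0 (truncn is the floor on
   nonnegative reals).  The value 0 taken after a quotient that is a natural
   number never occurs when a is irrational. *)
Fixpoint complete_quotient (R : realType) (a : R) (n : nat) : R :=
  if n is m.+1 then
    let z := complete_quotient a m in ((z - (Num.truncn z)%:R)^-1)%R
  else a.

Definition cfrac (R : realType) (a : R) (n : nat) : nat :=
  Num.truncn (complete_quotient a n).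

(* The denominators q_n for n >= 0; the two preceding values q_(-2) = 1 and
   q_(-1) = 0 have been substituted in the recurrence, so that q_0 = 1 and
   q_1 = d_1. *)
Fixpoint cf_denom (d : nat -> nat) (n : nat) : nat :=
  match n with
  | 0 => 1
  | m.+1 => if m is k.+1 then d n * cf_denom d m + cf_denom d k else d 1
  end.

(* An infinite word is a function w : nat -> T whose (i+1)-st letter is w i. *)
Definition letter (T : Type) (w : nat -> T) (n : nat) : T := w n.-1.

Definition purely_periodic (T : Type) (w : nat -> T) : Prop :=
  exists2 p, 0 < p & forall i, w (i + p) = w i.

Definition word_limit (T : Type) (s : nat -> seq T) (w : nat -> T) : Prop :=
  forall i, exists m, forall n, m <= n -> onth (s n) i = Some (w i).

(* The binary letters 0 and 1 are false and true. *)
Fixpoint standard_word (d : nat -> nat) (n : nat) : seq bool :=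
  match n with
  | 0 => [:: false]
  | m.+1 =>
      if m is k.+1 then
        flatten (nseq (d n) (standard_word d m)) ++ standard_word d k
      else rcons (nseq (d 1).-1 false) true
  end.

Definition characteristic_word (R : realType) (a : R) (c : nat -> bool) : Prop :=
  word_limit (standard_word (cfrac a)) c.

(* If the letter c i is preceded by j occurrences of itself, it is the
   (j+1)-st occurrence, whose replacement is the letter y j or y' j. *)
Definition colour (T : Type) (c : nat -> bool) (y y' : nat -> T) (i : nat) : T :=
  (if c i then y' else y) (\sum_(k < i) (c k == c i)).

(* Digit strings are written most significant digit first.  The leading digit
   is nonzero; otherwise the representation would not be unique. *)
Definition ostrowski_rep (d : nat -> nat) (N : nat) (s : seq nat) : Prop :=
  let b := nth 0 (rev s) in
  [/\ N = \sum_(i < size s) b i * cf_denom d i,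
      head 1 s != 0,
      0 < size s -> b 0 < d 1,
      forall i, 0 < i < size s -> b i <= d i.+1 &
      forall i, 0 < i < size s -> b i = d i.+1 -> b i.-1 = 0].

Record dfao (I : finType) (O : Type) := Dfao {
  dfao_state : finType;
  dfao_init : dfao_state;
  dfao_step : dfao_state -> I -> dfao_state;
  dfao_out : dfao_state -> O
}.

Definition dfao_run (I : finType) (O : Type) (A : dfao I O) (w : seq I) : O :=
  dfao_out (foldl (@dfao_step I O A) (dfao_init A) w).

(* The input alphabet is {0, ..., k-1} for some k exceeding all the digits
   that occur. *)
Definition ostrowski_automatic (R : realType) (a : R) (T : Type)
    (x : nat -> T) : Prop :=
  exists (k : nat) (A : dfao 'I_k T),
    forall n, 0 < n -> forall s, ostrowski_rep (cfrac a) n s ->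
      exists2 w : seq 'I_k, map val w = s & dfao_run A w = letter x n.

(* The next results justify the definite articles: c_a and the Ostrowski
   representation exist and are unique. *)

Lemma cfrac_gt0 (R : realType) (a : R) (n : nat) :
  (0 < a)%R -> irrational a -> 0 < cfrac a n.+1.
Proof.
move=> a0 aI.
have key : forall m, (0 < complete_quotient a m)%R /\
    irrational (complete_quotient a m).
  elim=> [//|m [z0 zI]] /=.
  set z := complete_quotient a m in z0 zI *.
  have /andP[lez _] := truncn_itv (ltW z0).
  have nez : (z - (Num.truncn z)%:R != 0)%R.
    apply/eqP => /eqP; rewrite subr_eq0 => /eqP e; apply: zI.
    by exists ((Num.truncn z)%:R)%R => //; rewrite ratr_nat -e.
  split; first by rewrite invr_gt0 lt_neqAle eq_sym nez subr_ge0.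
  case=> q _ eq; apply: zI; exists (q^-1 + (Num.truncn z)%:R)%R => //.
  by rewrite raddfD /= fmorphV ratr_nat /= eq invrK subrK.
have [z0 zI] := key n.
rewrite /cfrac /= truncn_gt0.
set z := complete_quotient a n in z0 zI *.
have /andP[lez ltz] := truncn_itv (ltW z0).
have [z'0 _] := key n.+1; rewrite /= -/z invr_gt0 in z'0.
rewrite -[X in (X <= _)%R]invr1 lef_pV2 ?posrE //.
by rewrite lerBlDr -natr1 addrC in ltz *; exact: ltW.
Qed.

Section Existence.
Variables (d : nat -> nat) (d_gt0 : forall n, 0 < d n.+1).
Local Notation q := (cf_denom d).

Lemma cf_denom_gt0 n : 0 < q n.
Proof.
elim/ltn_ind: n => -[|[|n]] IH //=.
by rewrite addn_gt0 IH ?orbT.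
Qed.

Lemma cf_denomSS n : q n.+2 = d n.+2 * q n.+1 + q n. Proof. by []. Qed.

Lemma leq_denomS n : q n <= q n.+1.
Proof.
case: n => [|n]; first exact: d_gt0.
by rewrite cf_denomSS (leq_trans _ (leq_addr _ _)) // leq_pmull.
Qed.

Lemma ltn_denomSS n : q n.+1 < q n.+2.
Proof.
by rewrite cf_denomSS -addn1 leq_add ?leq_pmull ?cf_denom_gt0 ?d_gt0.
Qed.

Lemma leq_denom n : n <= q n.
Proof.
by elim: n => [|[|n] IH]; rewrite ?cf_denom_gt0 // (leq_ltn_trans IH) ?ltn_denomSS.
Qed.

Lemma standard_word_prefix n :
  prefix (standard_word d n.+1) (standard_word d n.+2).
Proof.
rewrite [standard_word d n.+2]/=; case: (d n.+2) (d_gt0 n.+1) => // m _.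
by rewrite /= -catA; exact: prefix_prefix.
Qed.

Lemma size_standard_word n : size (standard_word d n) = q n.
Proof.
elim/ltn_ind: n => -[|[|n]] IH //.
  by rewrite /= size_rcons size_nseq prednK.
rewrite cf_denomSS -!IH // [standard_word d n.+2]/= size_cat.
by rewrite size_flatten /shape map_nseq sumn_nseq mulnC.
Qed.

Lemma word_limit_exists : exists c, word_limit (standard_word d) c.
Proof.
exists (fun i => nth false (standard_word d i.+1) i) => i; exists i.+1 => n lein.
have lti : i < size (standard_word d i.+1).
  by rewrite size_standard_word leq_denom.
have : prefix (standard_word d i.+1) (standard_word d n).
  elim: n lein => // n IH; rewrite leq_eqVlt => /predU1P[<-|]; first exact: prefix_refl.
  case: n IH => // n IH ltin; exact: prefix_trans (IH ltin) (standard_word_prefix n).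
case/prefixP => t ->.
by rewrite onthE map_cat nth_cat size_map lti (nth_map false).
Qed.

Let valid (b : nat -> nat) := [/\ b 0 < d 1, forall i, b i.+1 <= d i.+2 &
  forall i, b i.+1 = d i.+2 -> b i = 0].
Let value (b : nat -> nat) k := \sum_(i < k) b i * q i.

Let value_lt b k : valid b -> value b k < q k.
Proof.
case=> b0 bd bz; elim/ltn_ind: k => -[|[|k]] IH.
- by rewrite /value big_ord0.
- by rewrite /value big_ord1 muln1.
rewrite /value big_ord_recr -/(value b k.+1) cf_denomSS /=.
have := bd k; rewrite leq_eqVlt => /predU1P[e|ltb].
  by rewrite /value big_ord_recr /= (bz _ e) e addn0 addnC ltn_add2l IH.
apply: leq_trans (leq_addr _ _); apply: leq_trans (leq_mul ltb (leqnn _)).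
by rewrite mulSn ltn_add2r IH.
Qed.

Let valueS b k : value b k.+1 = value b k + b k * q k.
Proof. by rewrite /value big_ord_recr. Qed.

Let value_inj b b' k : valid b -> valid b' -> value b k = value b' k ->
  forall i, i < k -> b i = b' i.
Proof.
move=> vb vb'; elim: k => // k IH; rewrite !valueS => e i.
have eb : b k = b' k.
  have := congr1 (fun N => N %/ q k) e.
  rewrite /= ![value _ k + _]addnC !divnMDl ?cf_denom_gt0 //.
  by rewrite !divn_small ?value_lt // !addn0.
rewrite ltnS leq_eqVlt => /predU1P[->//|ltik]; apply: IH => //.
by move: e; rewrite eb; apply: addIn.
Qed.

Let value_surj k N : N < q k ->
  exists b, [/\ valid b, forall i, k <= i -> b i = 0 & value b k = N].
Proof.
elim: k N => [|k IH] N ltN.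
  exists (fun=> 0); split=> //; last by rewrite /value big_ord0; case: N ltN.
have [b [vb b0 bN]] := IH (N %% q k) (ltn_pmod _ (cf_denom_gt0 k)).
have [vb0 vbd vbz] := vb.
pose b' i := if i == k then N %/ q k else b i.
have vb' : value b' k.+1 = N.
  rewrite valueS {2}/b' eqxx [RHS](divn_eq N (q k)) addnC; congr (_ + _).
  by rewrite -bN; apply: eq_bigr => i _; rewrite /b' ltn_eqF.
have ltNq : N %/ q k < (d k.+1).+1 /\ (k = 0 -> N %/ q k < d 1) /\
    (forall j, k = j.+1 -> N %/ q k = d k.+1 -> b j = 0).
  case: k ltN b0 bN IH {b' vb'} => [|k] ltN b0 bN _.
    by rewrite divn1; split; [apply: ltnW|split].
  have qk := cf_denom_gt0 k.+1; split; last split=> //.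
    rewrite ltn_divLR // mulSn addnC; apply: leq_trans ltN _.
    by rewrite cf_denomSS leq_add2l leq_denomS.
  move=> _ [<-] e; apply/eqP; rewrite -leqn0 leqNgt; apply/negP => bk.
  have : value b k.+1 < q k.
    by rewrite bN -(ltn_add2l (N %/ q k.+1 * q k.+1)) -divn_eq e -cf_denomSS.
  by rewrite valueS ltnNge (leq_trans _ (leq_addl _ _)) // leq_pmull.
have [ltd [ltd0 bz]] := ltNq.
exists b'; split=> //.
- split=> [|i|i]; rewrite /b'.
  + by case: eqP => // e; apply: ltd0.
  + by case: eqP => // e; rewrite e; apply: ltd.
  case: eqP => [e|_ e]; last first.
    by case: eqP => [ik|_]; [have := b0 i.+1; rewrite -ik leqnSn e => /(_ isT) h; have := d_gt0 i.+1; rewrite h | apply: vbz].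
  by rewrite e => h; rewrite -{1}e ltn_eqF //; apply: bz.
- by move=> i ltki; rewrite /b' gtn_eqF // b0 // ltnW.
Qed.

Lemma ostrowski_rep_uniq N s s' :
  ostrowski_rep d N s -> ostrowski_rep d N s' -> s = s'.
Proof.
have pad t : ostrowski_rep d N t -> valid (nth 0 (rev t)) /\
    forall m, size t <= m -> value (nth 0 (rev t)) m = N.
  case=> e _ t0 td tz; split; last first.
    move=> m /subnKC <-; elim: (m - _) => [|j IH]; first by rewrite addn0 e.
    by rewrite addnS valueS IH nth_default ?size_rev ?leq_addr // addn0.
  split=> [|i|i].
  - by case: (posnP (size t)) => [/size0nil ->|/t0//]; rewrite d_gt0.
  - by case: (ltnP i.+1 (size t)) => lt; [apply: td | rewrite nth_default ?size_rev].
  case: (ltnP i.+1 (size t)) => lt; first by move=> h; apply: (tz i.+1).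
  rewrite nth_default ?size_rev // => h; have := d_gt0 i.+1; by rewrite -h.
have half t t' : ostrowski_rep d N t -> ostrowski_rep d N t' ->
    (forall i, nth 0 (rev t) i = nth 0 (rev t') i) -> size t <= size t'.
  case=> _ ht _ _ _ _ eqt; rewrite leqNgt; apply/negP => lt.
  move: ht; case: t lt eqt => // x t lt eqt /=.
  have := eqt (size t); rewrite rev_cons nth_rcons size_rev ltnn eqxx => ->.
  by rewrite nth_default // size_rev.
move=> rs rs'; have [vs es] := pad _ rs; have [vs' es'] := pad _ rs'.
have eqb i : nth 0 (rev s) i = nth 0 (rev s') i.
  set m := maxn (size s) (maxn (size s') i.+1).
  apply: (@value_inj _ _ m) => //; first by rewrite es ?es' // /m !leq_max leqnn ?orbT.
  by rewrite /m !leq_max leqnn !orbT.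
have sz : size s = size s'.
  by apply/eqP; rewrite eqn_leq (half s s') ?(half s' s).
apply: (can_inj revK); apply: (@eq_from_nth _ 0) => [|i _]; last exact: eqb.
by rewrite !size_rev.
Qed.

Lemma ostrowski_rep_exists N : exists s, ostrowski_rep d N s.
Proof.
have ex : exists k, N < q k by exists N.+1; apply: leq_denom.
case: (ex_minnP ex) => k ltN mink.
have [b [[b0 bd bz] _ bN]] := value_surj ltN.
exists (rev (mkseq b k)); split; rewrite ?revK ?size_rev ?size_mkseq.
- rewrite -bN; apply: eq_bigr => i _; by rewrite nth_mkseq.
- case: k ltN mink bN => // k ltN mink bN.
  rewrite -nth0 nth_rev ?size_mkseq // subn1 /= nth_mkseq //.
  apply/eqP => bk; have := mink k; rewrite ltnn -bN valueS bk addn0.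
  by rewrite value_lt // => /(_ isT).
- by move=> k0; rewrite nth_mkseq.
- by case=> // i /andP[_ lt]; rewrite nth_mkseq.
by case=> // i /andP[_ lt]; rewrite !nth_mkseq //= ?(ltnW lt) //; apply: bz.
Qed.

End Existence.

Lemma characteristic_word_exists (R : realType) (a : R) :
  (0 < a)%R -> irrational a -> exists c, characteristic_word a c.
Proof.
by move=> a0 aI; apply: word_limit_exists => n; apply: cfrac_gt0.
Qed.

Lemma word_limit_uniq (T : Type) (s : nat -> seq T) (w w' : nat -> T) :
  word_limit s w -> word_limit s w' -> w =1 w'.
Proof.
move=> sw sw' i; have [m wm] := sw i; have [m' wm'] := sw' i.
have := wm _ (leq_maxl m m'); rewrite wm' ?leq_maxr // => e.
by case: e.
Qed.

(* Main.v *)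
(* By Lagrange's theorem the partial quotients of alpha are eventually periodic.
   If b_(k-1) ... b_0 represents n, the prefix of length n of c_alpha is
   s_(k-1)^b_(k-1) ... s_0^b_0, and the n-th letter of the coloured word depends
   only on the last letter of this prefix and on its numbers of 0s and 1s modulo
   a common period of y and y', hence on its image in a finite quotient of the
   monoid of binary words.  The images of the s_k obey a recurrence with
   eventually periodic coefficients, so a finite automaton computes the image of
   the prefix from the least significant digit on; letting the states be the
   transformations of its state set reverses the direction of reading. *)
Require Import Defs.
From mathcomp Require Import all_boot all_order all_algebra.
From mathcomp Require Import classical_sets reals.
From mathcomp Require Import zify ring lra.

Set Implicit Arguments.
Unset Strict Implicit.
Unset Printing Implicit Defensive.

Import Order.TTheory GRing.Theory Num.Theory.

Definition eventually_periodic (T : Type) (u : nat -> T) : Prop :=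
  exists m p, 0 < p /\ forall n, m <= n -> u (n + p) = u n.

Lemma pigeonhole (F : finType) (u : nat -> F) : exists i j, i < j /\ u i = u j.
Proof.
pose f (i : 'I_#|F|.+1) := u i.
have /injectivePn [i [j neij eij]] : ~~ injectiveb f.
  by apply/injectiveP => /leq_card; rewrite card_ord ltnn.
by move: neij; rewrite -val_eqE neq_ltn => /orP[] lt; [exists i, j | exists j, i].
Qed.

(** * Lagrange's theorem *)

Section CompleteQuotients.
Local Open Scope ring_scope.
Variables (R : realType) (a : R).
Hypotheses (a_gt0 : 0 < a) (a_irr : irrational a).
Local Notation z := (complete_quotient a).
Local Notation d := (cfrac a).

Lemma irrational_neq_ratr (x : R) (q : rat) : irrational x -> x != ratr q.
Proof. by move=> xI; apply/eqP => e; apply: xI; exists q. Qed.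

Lemma complete_quotient_gt0_irr n : 0 < z n /\ irrational (z n).
Proof.
elim: n => [//|n [z0 zI]] /=.
have /andP[lez _] := truncn_itv (ltW z0).
split.
  rewrite invr_gt0 subr_gt0 lt_neqAle lez andbT eq_sym.
  by rewrite -[X in _ != X]ratr_nat irrational_neq_ratr.
case=> q _ eq; apply: zI; exists (q^-1 + (Num.truncn (z n))%:R) => //.
by rewrite raddfD /= fmorphV ratr_nat /= eq invrK subrK.
Qed.

Lemma complete_quotient_gt0 n : 0 < z n.
Proof. by case: (complete_quotient_gt0_irr n). Qed.

Lemma complete_quotient_irr n : irrational (z n).
Proof. by case: (complete_quotient_gt0_irr n). Qed.

Lemma cfrac_lt n : (d n)%:R < z n.
Proof.
have /andP[lez _] := truncn_itv (ltW (complete_quotient_gt0 n)).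
rewrite lt_neqAle lez andbT eq_sym -[X in _ != X]ratr_nat.
exact/irrational_neq_ratr/complete_quotient_irr.
Qed.

Lemma lt_cfracS n : z n < (d n)%:R + 1.
Proof.
have /andP[_] := truncn_itv (ltW (complete_quotient_gt0 n)).
by rewrite -natr1.
Qed.

Section Form.
Variables (A B C : nat -> int).
Hypotheses (A_neq0 : A 0 != 0)
  (root0 : (A 0)%:~R * z 0 ^+ 2 + (B 0)%:~R * z 0 + (C 0)%:~R = 0).
Hypotheses (AS : forall n, A n.+1 = A n * (d n)%:Z ^+ 2 + B n * (d n)%:Z + C n)
  (BS : forall n, B n.+1 = 2 * A n * (d n)%:Z + B n)
  (CS : forall n, C n.+1 = A n).

(** Substituting [z n = d n + 1 / z n.+1] and clearing denominators gives exactly the recurrences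
    for [A], [B], [C]. *)
Lemma form_root n :
  (A n)%:~R * z n ^+ 2 + (B n)%:~R * z n + (C n)%:~R = 0.
Proof.
elim: n => [//|n IH]; rewrite AS BS CS /= -/(d n).
have nz : z n - (d n)%:R != 0 by rewrite subr_eq0 gt_eqF // cfrac_lt.
rewrite -[RHS](mulr0 ((z n - (d n)%:R)^-1 ^+ 2)) -IH.
rewrite !(rmorphD, rmorphXn, rmorphM) /=.
by field.
Qed.

(** Otherwise [z n.+1] would solve a linear equation with nonzero constant term [A n], hence be
    rational. *)
Lemma form_lead_neq0 n : (A n)%:~R != 0 :> R.
Proof.
elim: n => [|n IH]; first by rewrite intr_eq0.
apply/eqP => A0; have := form_root n.+1; rewrite A0 mul0r add0r CS => /eqP.
rewrite addr_eq0 => /eqP e.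
have B0 : (B n.+1)%:~R != 0 :> R.
  by apply/eqP => B0; move: e IH; rewrite B0 mul0r => /esym/eqP; rewrite oppr_eq0 => ->.
have := irrational_neq_ratr (- (A n)%:~R / (B n.+1)%:~R) (@complete_quotient_irr n.+1).
rewrite rmorphM /= fmorphV rmorphN /= !ratr_int -e mulrAC divff //.
by rewrite mul1r eqxx.
Qed.

(** The second root of the form, obtained from the sum of the roots. *)
Definition conj_quotient n : R := - (B n)%:~R / (A n)%:~R - z n.
Local Notation z' := conj_quotient.

Lemma formE n x : (A n)%:~R * x ^+ 2 + (B n)%:~R * x + (C n)%:~R =
  (A n)%:~R * (x - z n) * (x - z' n).
Proof.
have nz := form_lead_neq0 n.
rewrite -[LHS]subr0 -(form_root n) /conj_quotient.
by field.
Qed.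

Lemma form_leadS n : (A n.+1)%:~R =
  (A n)%:~R * ((d n)%:R - z n) * ((d n)%:R - z' n).
Proof. by rewrite -formE AS !(rmorphD, rmorphXn, rmorphM) /=. Qed.

Lemma conj_quotient_neq n : z' n - (d n)%:R != 0.
Proof.
have := form_lead_neq0 n.+1; rewrite form_leadS mulf_eq0 negb_or => /andP[_].
by rewrite -opprB oppr_eq0.
Qed.

(** Conjugation fixes the integer [d n], so the recursion of the complete quotients carries over. *)
Lemma conj_quotientS n : z' n.+1 = (z' n - (d n)%:R)^-1.
Proof.
have nz := form_lead_neq0 n; have nz' := conj_quotient_neq n.
have nzz : z n - (d n)%:R != 0 by rewrite subr_eq0 gt_eqF // cfrac_lt.
have e : (B n)%:~R = - (A n)%:~R * (z n + z' n).
  by rewrite /conj_quotient; field.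
rewrite [LHS]/conj_quotient form_leadS BS /= -/(d n) rmorphD !rmorphM /= e.
have -> : (d n)%:R - z n = - (z n - (d n)%:R) by ring.
have -> : (d n)%:R - z' n = - (z' n - (d n)%:R) by ring.
by field; rewrite nz nzz nz'.
Qed.

(* As long as the conjugate lies in the same unit interval as the quotient,
   the absolute value of the leading coefficient strictly decreases. *)
Lemma conj_quotient_lt0_exists : exists N, z' N < 0.
Proof.
suff H m n : (`|A n| <= m)%N -> exists N, z' N < 0 by exact: (H _ 0 (leqnn _)).
elim: m n => [|m IH] n.
  rewrite leqn0 absz_eq0 => /eqP A0.
  by have := form_lead_neq0 n; rewrite A0 eqxx.
move=> leA.
have done1 k : z' k < (d k)%:R -> exists N, z' N < 0.
  by move=> lt; exists k.+1; rewrite conj_quotientS invr_lt0 subr_lt0.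
case: (ltP (z' n) (d n)%:R) => [|ge]; first exact: done1.
have gt : (d n)%:R < z' n.
  by rewrite lt_neqAle ge eq_sym -subr_eq0 conj_quotient_neq.
(* From [d n + 1] upwards, the next conjugate is at most 1, hence below [d n.+1], and the one after
   it is negative. *)
case: (ltP (z' n) ((d n)%:R + 1)) => [lt|ge1]; last first.
  apply: (done1 n.+1); rewrite lt_neqAle -subr_eq0 conj_quotient_neq /=.
  apply: (@le_trans _ _ 1); last by rewrite ler1n cfrac_gt0.
  by rewrite conj_quotientS invf_le1 ?subr_gt0 // lerBrDr addrC.
(* The leading coefficient gets multiplied by [(z n - d n) * (z' n - d n)], both factors lying in
   (0, 1). *)
apply: (IH n.+1); rewrite -ltnS; apply: leq_trans leA.
rewrite -ltz_nat !abszE -(ltr_int R) !intr_norm form_leadS !normrM.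
rewrite -mulrA gtr_pMr ?normr_gt0 ?form_lead_neq0 //.
rewrite ![`|(d n)%:R - _|]distrC; have := cfrac_lt n; have := lt_cfracS n => z1 z0.
rewrite !gtr0_norm ?subr_gt0 // mulr_ilt1 ?subr_ge0 ?ltW // ltrBlDl //.
Qed.

Lemma conj_quotient_lt0 N n : (N <= n)%N -> z' N < 0 -> z' n < 0.
Proof.
move=> /subnKC <- lt0; elim: (n - N)%N => [|k IH]; first by rewrite addn0.
by rewrite addnS conj_quotientS invr_lt0 subr_lt0 (lt_le_trans IH) ?ler0n.
Qed.

Lemma form_disc n : B n ^+ 2 - 4 * A n * C n = B 0 ^+ 2 - 4 * A 0 * C 0.
Proof. by elim: n => [//|n <-]; rewrite AS BS CS; ring. Qed.

(** [C n / A n] is the product of the roots, one positive and one negative. *)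
Lemma form_indefinite n : z' n < 0 -> A n * C n < 0.
Proof.
move=> lt0; have := formE n 0; rewrite expr0n !mulr0 !add0r => e.
rewrite -(ltrz0 R) rmorphM /= e.
have -> : (A n)%:~R * ((A n)%:~R * - z n * - z' n) =
  (A n)%:~R ^+ 2 * z n * z' n :> R by ring.
rewrite nmulr_llt0 // mulr_gt0 ?complete_quotient_gt0 //.
by rewrite exprn_even_gt0 //= form_lead_neq0.
Qed.

(** The discriminant is invariant, and opposite signs of [A n] and [C n] make it a sum of
    nonnegative terms dominating each coefficient. *)
Lemma form_bound n : z' n < 0 ->
  [/\ (`|A n| <= `|(B 0 ^+ 2 - 4 * A 0 * C 0)%R|)%N,
      (`|B n| <= `|(B 0 ^+ 2 - 4 * A 0 * C 0)%R|)%N &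
      (`|C n| <= `|(B 0 ^+ 2 - 4 * A 0 * C 0)%R|)%N].
Proof.
move/form_indefinite; rewrite -(form_disc n).
move: (A n) (B n) (C n) => x y w lt.
have e : (`|(y ^+ 2 - 4 * x * w)%R| = `|y| ^ 2 + 4 * (`|x| * `|w|))%N.
  by rewrite -abszX -abszM; lia.
have x0 : (0 < `|x|)%N by rewrite absz_gt0; apply: contraTneq lt => ->; rewrite mul0r ltxx.
have w0 : (0 < `|w|)%N by rewrite absz_gt0; apply: contraTneq lt => ->; rewrite mulr0 ltxx.
by rewrite e; split; nia.
Qed.

Lemma complete_quotient_eq i j : z' i < 0 ->
  A i = A j -> B i = B j -> C i = C j -> z j = z i.
Proof.
move=> lt0 eA eB eC; have := form_root j; rewrite -eA -eB -eC formE => /eqP.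
rewrite !mulf_eq0 (negbTE (form_lead_neq0 i)) /= !subr_eq0 => /orP[/eqP//|/eqP e].
by have := complete_quotient_gt0 j; rewrite e ltNge ltW.
Qed.

Lemma cfrac_periodic_of_form : eventually_periodic d.
Proof.
have [N ltN] := conj_quotient_lt0_exists.
pose K := `|(B 0 ^+ 2 - 4 * A 0 * C 0)%R|%N.
(* Adding [K] embeds the integers of absolute value at most [K] into 0..2K, so the triples range
   over a finite set. *)
pose enc (x : int) : 'I_(2 * K).+1 := inord `|x + K%:Z|.
have encI (x y : int) : (`|x| <= K)%N -> (`|y| <= K)%N -> enc x = enc y -> x = y.
  move=> lex ley /(congr1 val); rewrite /= !inordK; lia.
have [i [j [ltij [eA eB eC]]]] :=
  pigeonhole (fun n => (enc (A (N + n)), enc (B (N + n)), enc (C (N + n))))%N.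
have lt k : z' (N + k) < 0 by apply: (@conj_quotient_lt0 N); rewrite ?leq_addr.
have [Ai Bi Ci] := form_bound (lt i); have [Aj Bj Cj] := form_bound (lt j).
have e : z (N + j) = z (N + i).
  by apply: complete_quotient_eq => //; apply: encI.
exists (N + i)%N, (j - i)%N; rewrite subn_gt0; split=> // n /subnKC <-.
have -> : (N + i + (n - (N + i)) + (j - i) = N + j + (n - (N + i)))%N by lia.
rewrite /cfrac; congr Num.truncn.
elim: (n - _)%N => [|k IH]; first by rewrite !addn0.
by rewrite !addnS /= IH.
Qed.

End Form.
End CompleteQuotients.

Section FormSequence.
Local Open Scope ring_scope.

Fixpoint quotient_form (A B C : int) (d : nat -> nat) (n : nat) : int * int * int :=
  if n is m.+1 then
    let: (A', B', C') := quotient_form A B C d m in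
    (A' * (d m)%:Z ^+ 2 + B' * (d m)%:Z + C', 2 * A' * (d m)%:Z + B', A')
  else (A, B, C).

Lemma quadratic_cfrac_periodic (R : realType) (a : R) :
  0 < a -> quadratic_irrational a -> eventually_periodic (cfrac a).
Proof.
move=> a_gt0 [aI [p sp rp]].
pose f := quotient_form p`_2 p`_1 p`_0 (cfrac a).
apply: (@cfrac_periodic_of_form _ _ a_gt0 aI (fun n => (f n).1.1)
  (fun n => (f n).1.2) (fun n => (f n).2)); rewrite /f.
- by have := lead_coef_eq0 p; rewrite lead_coefE sp /= => ->; rewrite -size_poly_eq0 sp.
- move: rp; rewrite rootE horner_coef size_map_poly_id0; last first.
    by rewrite intr_eq0 lead_coef_eq0 -size_poly_eq0 sp.
  rewrite sp !big_ord_recr big_ord0 /= !coef_map /= => /eqP <-; ring.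
- by move=> n /=; case: quotient_form => -[].
- by move=> n /=; case: quotient_form => -[].
- by move=> n /=; case: quotient_form => -[].
Qed.

End FormSequence.

(** * The automaton *)

(** A counter runs through the preperiod and one period, then returns from [m + p - 1] to [m]. *)
Lemma eventually_periodic_generated (T : Type) (u : nat -> T) :
  eventually_periodic u ->
  exists (Q : finType) (q0 : Q) (next : Q -> Q) (out : Q -> T),
    forall n, u n = out (iter n next q0).
Proof.
move=> [m [p [p_gt0 up]]].
pose next (i : 'I_(m + p).-1.+1) : 'I_(m + p).-1.+1 :=
  inord (if i.+1 < m + p then i.+1 else m).
exists 'I_(m + p).-1.+1, ord0, next, (fun i : 'I_(m + p).-1.+1 => u i) => n.
(* Comparing all shifts [k] makes the induction compare whole tails of [u], which the jump back to
   [m] preserves. *)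
suff H k : u (n + k) = u (iter n next ord0 + k) by rewrite -[n in LHS]addn0 H addn0.
elim: n k => [//|n IH] k; rewrite addSnnS IH /= {2}/next.
set i := iter n next ord0; case: ifP => lt; first by rewrite inordK ?addSnnS //; lia.
rewrite inordK; last lia.
by rewrite -(up (m + k)) ?leq_addr //; congr u; have := ltn_ord i; lia.
Qed.

(** The state is the transformation of [Q] induced by the letters read; a new letter acts before
    them, so it is composed on the inside. *)
Lemma foldr_dfao (I Q : finType) (O : Type) (step : I -> Q -> Q) (q0 : Q)
    (out : Q -> O) :
  exists A : dfao I O, forall w, dfao_run A w = out (foldr step q0 w).
Proof.
exists (@Dfao I O {ffun Q -> Q} (finfun id)
  (fun f a => [ffun q => f (step a q)]) (fun f => out (f q0))) => w.
rewrite /dfao_run /=; congr out; rewrite -[RHS](ffunE id).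
by elim: w (finfun id) => //= a w IH f; rewrite IH ffunE.
Qed.

(** * Prefixes of the characteristic word spelled by Ostrowski digits *)

Section StandardWords.
Variable d : nat -> nat.
Hypothesis d_gt0 : forall n, 0 < d n.+1.
Local Notation std := (standard_word d).

Definition block (n : nat) (w : seq bool) : seq bool := flatten (nseq n w).

(* For [t = b_(k-1) ... b_0] this is [s_(k-1)^b_(k-1) ... s_0^b_0]. *)
Fixpoint digits_word (t : seq nat) : seq bool :=
  if t is b :: t' then block b (std (size t')) ++ digits_word t' else [::].

(** The digit conditions by recursion from the most significant digit; leading zeros are allowed so
    that tails stay admissible. *)
Fixpoint admissible (t : seq nat) : bool :=
  match t with
  | [::] => true
  | b :: t' =>
      if t' is b' :: _ then
        [&& b <= d (size t), (b == d (size t)) ==> (b' == 0) & admissible t']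
      else b < d 1
  end.

Lemma ostrowski_rep_admissible N t : ostrowski_rep d N t -> admissible t.
Proof.
case=> _ _; elim: t {N} => [//|b [_ /(_ isT)//|b' t] IH] t0 td tz.
set v := b' :: t in IH t0 td tz *.
have nthE i : i < size v -> nth 0 (rev (b :: v)) i = nth 0 (rev v) i.
  by move=> lt; rewrite rev_cons nth_rcons size_rev lt.
have nthb : nth 0 (rev (b :: v)) (size v) = b.
  by rewrite rev_cons nth_rcons size_rev ltnn eqxx.
rewrite /= -/v; apply/and3P; split.
- by rewrite -nthb; apply: td; rewrite /= ltnSn.
- apply/implyP => /eqP e; have := tz (size v); rewrite nthb /= ltnSn => /(_ isT e).
  by rewrite nthE // /v /= rev_cons nth_rcons size_rev ltnn eqxx => ->.
apply: IH => [_|i /andP[i0 lti]|i /andP[i0 lti]].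
- by rewrite -nthE //; apply: t0.
- by rewrite -nthE //; apply: td; rewrite i0 /= ltnW.
rewrite -!nthE // ?(leq_ltn_trans (leq_pred _)) //.
by apply: tz; rewrite i0 /= ltnW.
Qed.

Lemma size_digits_word t :
  size (digits_word t) = \sum_(i < size t) nth 0 (rev t) i * cf_denom d i.
Proof.
elim: t => [|b t IH]; first by rewrite big_ord0.
rewrite big_ord_recr /= rev_cons nth_rcons size_rev ltnn eqxx size_cat IH addnC.
rewrite size_flatten /shape map_nseq sumn_nseq size_standard_word // mulnC.
by congr (_ + _); apply: eq_bigr => i _; rewrite nth_rcons size_rev ltn_ord.
Qed.

Lemma prefix_block w m n u : prefix u w -> m < n -> prefix (block m w ++ u) (block n w).
Proof.
move=> uw /subnKC <-; rewrite /block addSnnS nseqD flatten_cat.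
by rewrite prefix_catr //= eqxx prefix_catl.
Qed.

(* [b_(k+1) = d_(k+2)] is compensated by [b_k = 0], since
   [s_(k+2) = s_(k+1)^d_(k+2) s_k]. *)
Lemma digits_word_prefix t : admissible t -> prefix (digits_word t) (std (size t)).
Proof.
(* Induction on the length, since a maximal leading digit removes two digits at once. *)
have [n] := ubnP (size t); elim: n t => // n IH [|b [|b' t]] //.
  move=> _ /= lt; rewrite cats0; apply: (prefix_trans (y := nseq (d 1).-1 false)).
    have -> : block b [:: false] = nseq b false by rewrite /block; elim: b {lt} => //= b ->.
    have /subnKC <- : b <= (d 1).-1 by rewrite -ltnS prednK.
    by rewrite nseqD prefix_prefix.
  exact: prefix_rcons.
move=> lt; rewrite [admissible _]/= => /and3P[le /implyP eb adm].
have Pt := IH (b' :: t) lt adm.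
move: le; rewrite leq_eqVlt => /predU1P[e|ltb]; last first.
  by rewrite [std _]/=; apply/prefix_catl/prefix_block.
have b'0 : b' = 0 by apply/eqP/eb; rewrite e.
rewrite [std _]/= [digits_word _]/= e b'0 /= prefix_catr //= eqxx /=.
apply: IH; first by rewrite -ltnS ltnW.
move: adm; rewrite b'0; case: (t) => //= b'' t'.
by case/andP.
Qed.

Lemma mkseq_digits_word (c : nat -> bool) t : word_limit std c ->
  admissible t -> mkseq c (size (digits_word t)) = digits_word t.
Proof.
move=> sc /digits_word_prefix; case: t => // b t; set w := digits_word _ => Pw.
(* Here [m] is at least 1: the chain of prefixes starts at [std 1], as [std 0] is not a prefix of it
   when [d 1 = 1]. *)
have Pm m : size t < m -> prefix w (std m).
  elim: m => // m IH; rewrite leq_eqVlt => /predU1P[<- //|].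
  by case: m IH => // m IH lt; apply: prefix_trans (IH lt) (standard_word_prefix d_gt0 m).
apply: (@eq_from_nth _ false); rewrite size_mkseq // => i lti; rewrite nth_mkseq //.
have [m sm] := sc i; have := sm _ (leq_maxl m (size t).+1).
have /prefixP[v ->] := Pm (maxn m (size t).+1) (leq_maxr _ _).
by rewrite onthE map_cat nth_cat size_map lti (nth_map false) // => -[].
Qed.

(** * Computing a finite multiplicative image of the digit word *)

Section Automaton.
Variables (M : finType) (mu : seq bool -> M) (mul : M -> M -> M).
Hypothesis mu_cat : forall u v, mu (u ++ v) = mul (mu u) (mu v).
Variables (Q : finType) (q0 : Q) (next : Q -> Q) (out : Q -> nat).
Hypothesis out_iter : forall n, d n.+2 = out (iter n next q0).

Definition pow_block (b : nat) (x : M) : M := iter b (mul x) (mu [::]).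

Lemma mu_block b w : mu (block b w) = pow_block b (mu w).
Proof. by elim: b => //= b <-; rewrite mu_cat. Qed.

(* After reading [k] digits from the least significant one, the state holds the
   phase of [d], the images of [s_k] and [s_(k+1)], and that of the word
   spelled so far. *)
Definition digit_step (b : nat) (s : Q * M * M * M) : Q * M * M * M :=
  let: (q, x, y, w) := s in
  (next q, y, mul (pow_block (out q) y) x, mul (pow_block b x) w).

Lemma foldr_digit_step t :
  foldr digit_step (q0, mu (std 0), mu (std 1), mu [::]) t =
  (iter (size t) next q0, mu (std (size t)), mu (std (size t).+1),
   mu (digits_word t)).
Proof.
by elim: t => //= b t ->; rewrite /= -out_iter !mu_cat -!mu_block.
Qed.

Lemma digits_word_dfao k (O : Type) (f : M -> O) : exists A : dfao 'I_k O,
  forall w, dfao_run A w = f (mu (digits_word (map val w))).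
Proof.
have [A HA] := foldr_dfao (fun a : 'I_k => digit_step a)
  (q0, mu (std 0), mu (std 1), mu [::]) (fun s => f s.2).
exists A => w; rewrite HA.
suff -> : foldr (fun a : 'I_k => digit_step a)
    (q0, mu (std 0), mu (std 1), mu [::]) w =
  foldr digit_step (q0, mu (std 0), mu (std 1), mu [::]) (map val w).
  by rewrite foldr_digit_step.
by elim: w => //= a w ->.
Qed.

End Automaton.
End StandardWords.

Lemma admissible_le d K t : (forall n, d n.+1 <= K) -> admissible d t ->
  all (fun b => b <= K) t.
Proof.
move=> dK; elim: t => // b [_ /= lt|b' t IH]; first by rewrite (leq_trans (ltnW lt)).
rewrite [admissible _ _]/= => /and3P[le _ adm].
by apply/andP; split; [exact: leq_trans le (dK _) | exact: IH].
Qed.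

(** * The coloured letter from letter counts modulo a common period *)

Section Colour.
Variables (T : Type) (y y' : nat -> T) (P : nat).
Hypotheses (yP : forall i, y (i + P.+1) = y i) (y'P : forall i, y' (i + P.+1) = y' i).

Lemma periodic_modn (z : nat -> T) : (forall i, z (i + P.+1) = z i) ->
  forall i, z (i %% P.+1) = z i.
Proof.
move=> zP i; rewrite {2}(divn_eq i P.+1) addnC.
by elim: (i %/ _) => [|k IH]; rewrite ?addn0 // mulSnr addnA zP.
Qed.

Definition profile (w : seq bool) : 'I_P.+1 * 'I_P.+1 * option bool :=
  (inZp (count_mem false w), inZp (count_mem true w), ohead (rev w)).

Definition profile_mul (x x' : 'I_P.+1 * 'I_P.+1 * option bool) :=
  (inZp (x.1.1 + x'.1.1) : 'I_P.+1, inZp (x.1.2 + x'.1.2) : 'I_P.+1,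
   if x'.2 is Some a then Some a else x.2).

Lemma profile_cat u v : profile (u ++ v) = profile_mul (profile u) (profile v).
Proof.
rewrite /profile /profile_mul /= !count_cat rev_cat; congr (_, _, _).
- by apply: val_inj; rewrite /= modnDm.
- by apply: val_inj; rewrite /= modnDm.
by case: (rev v).
Qed.

(* Adding [P] instead of subtracting [1] keeps the index nonnegative. *)
Definition profile_colour (x : 'I_P.+1 * 'I_P.+1 * option bool) : T :=
  if x.2 is Some true then y' (x.1.2 + P) else y (x.1.1 + P).

Lemma profile_mkseq c n : 0 < n ->
  letter (colour c y y') n = profile_colour (profile (mkseq c n)).
Proof.
case: n => // n _.
have lastE : ohead (rev (mkseq c n.+1)) = Some (c n) by rewrite mkseqS rev_rcons.
(* The count includes the last letter itself, while [colour] counts earlier occurrences only. *)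
have cntE : count_mem (c n) (mkseq c n.+1) = (\sum_(k < n) (c k == c n)).+1.
  rewrite mkseqS -cats1 count_cat /= eqxx addn1; congr _.+1.
  by rewrite -sum1_count big_map big_mkcond /= -[n in iota 0 n]subn0 big_mkord.
have main (z : nat -> T) m : (forall i, z (i + P.+1) = z i) ->
    z m = z (m.+1 %% P.+1 + P).
  by move=> zP; rewrite -(periodic_modn zP (_ + P)) modnDml periodic_modn // addSnnS zP.
rewrite /letter /colour; move: (mkseq c n.+1) lastE cntE => w lastE.
by rewrite /profile_colour /= lastE; case: (c n) => ->; rewrite -main.
Qed.

End Colour.

Theorem theorem15 (R : realType) (alpha : R)
    (alpha01 : (0 < alpha < 1)%R) (alpha_quad : quadratic_irrational alpha)
    (c : nat -> bool) (c_char : characteristic_word alpha c)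
    (T : Type) (y y' : nat -> T)
    (y_per : purely_periodic y) (y'_per : purely_periodic y') :
  ostrowski_automatic alpha (colour c y y').
Proof.
have /andP[alpha_gt0 _] := alpha01.
have d_gt0 n : 0 < cfrac alpha n.+1 by apply: cfrac_gt0 => //; case: alpha_quad.
have [m [p [p_gt0 dp]]] := quadratic_cfrac_periodic alpha_gt0 alpha_quad.
(* After [n] digits the automaton holds the images of [s_n] and [s_(n+1)] and needs [d_(n+2)] to
   form the next one. *)
have dSS_per : eventually_periodic (fun n => cfrac alpha n.+2).
  by exists m, p; split=> // n le; apply: (dp n.+2); exact/leqW/leqW.
have [Q [q0 [next [out outE]]]] := eventually_periodic_generated dSS_per.
have [K leK] : exists K, forall n, cfrac alpha n.+1 <= K.
  (* All partial quotients from the second on are outputs of the finite counter. *)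
  exists (maxn (cfrac alpha 1) (\max_q out q)) => -[|n]; first exact: leq_maxl.
  by rewrite outE leq_max orbC leq_bigmax.
have [p1 p1_gt0 yp1] := y_per; have [p2 p2_gt0 yp2] := y'_per.
pose P := (p1 * p2).-1; have PE : P.+1 = p1 * p2 by rewrite prednK ?muln_gt0 ?p1_gt0.
have mulP (z : nat -> T) r : (forall i, z (i + r) = z i) ->
    forall k i, z (i + r * k) = z i.
  by move=> zr; elim=> [|k IH] i; rewrite ?muln0 ?addn0 // mulnS addnA IH zr.
have yP i : y (i + P.+1) = y i by rewrite PE mulP.
have y'P i : y' (i + P.+1) = y' i by rewrite PE mulnC mulP.
have [A HA] :=
  digits_word_dfao (@profile_cat P) outE K.+1 (@profile_colour T y y' P).
exists K.+1, A => n n_gt0 s rs; have adm := ostrowski_rep_admissible rs.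
(* The bound [K] on the digits makes [inord] lossless. *)
have valK : map val (map (@inord K) s) = s.
  rewrite -map_comp -[RHS]map_id; apply/eq_in_map => b bs /=.
  by rewrite inordK // ltnS (allP (admissible_le leK adm)).
exists (map inord s) => //; rewrite HA valK (profile_mkseq yP y'P _ n_gt0).
have [nE _ _ _ _] := rs.
by rewrite -(mkseq_digits_word d_gt0 c_char adm) size_digits_word // -nE.
Qed.
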